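(* Let $\mathbf{D}$ be an Abelian category of finite length. Then the function $\mathrm{length}:\mathrm{Obj}(\mathbf{D})\to\mathbb{Z}$ is a strict $0$-based fiber-wise rank.
   Context: In an Abelian category, an object $X$ has finite length $n=\mathrm{length}(X)$ if there is a series $0\simeq X_0\hookrightarrow X_1\hookrightarrow\dots\hookrightarrow X_n\simeq X$ with all quotients $X_i/X_{i-1}$ simple. The category has finite length if all its objects have finite length. Rank function on a regular category $\mathbf{R}$ (every Abelian category is regular): a lower-bounded $r:\mathrm{Obj}(\mathbf{R})\to\mathbb{Z}$ such that: (1) $r(A)\le r(B)$ for any monomorphism $A\hookrightarrow B$; (2) $r(B)\ge r(D)$ for any regular epimorphism $B\twoheadrightarrow D$; (3) for any pullback square with monomorphisms $A\hookrightarrow B$, $C\hookrightarrow D$ and regular epimorphisms $A\twoheadrightarrow C$, $B\twoheadrightarrow D$, $r(B)-r(A)\ge r(D)-r(C)$. It is strict if the inequalities in (1) and (2) are strict unless the morphism is invertible. It is $0$-based if $\mathbf{R}$ has an initial object $\emptyset$ and $r(\emptyset)=0$. Fiber-wise: with $\mathrm{pt}$ the terminal object of $\mathbf{R}$, $r:\mathrm{Obj}(\mathbf{R})\to\mathbb{Z}$ is fiber-wise if for every regular epimorphism $\phi:B\twoheadrightarrow D$, $$r(B)-r(D)=\sum_{\iota\in\mathrm{Hom}(\mathrm{pt},D)}\bigl(r(B\times_D^{\iota}\mathrm{pt})-r(\mathrm{pt})\bigr),$$ where $B\times_D^{\iota}\mathrm{pt}$ is the pullback of $\phi$ along $\iota:\mathrm{pt}\to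 D$. *)

(* Defs.v *)
From mathcomp Require Import all_boot all_order all_algebra.
From mathcomp Require Import boolp classical_sets functions cardinality fsbigop.

Set Implicit Arguments.
Unset Strict Implicit.
Unset Printing Implicit Defensive.

Import Order.TTheory GRing.Theory Num.Theory.
Local Open Scope ring_scope.
Local Open Scope classical_set_scope.

Record category := Category {
  obj :> Type;
  hom : obj -> obj -> Type;
  idm : forall A, hom A A;
  comp : forall A B C, hom B C -> hom A B -> hom A C;
  comp1m : forall A B (f : hom A B), comp (idm B) f = f;
  compm1 : forall A B (f : hom A B), comp f (idm A) = f;
  compA : forall A B C D (h : hom C D) (g : hom B C) (f : hom A B),
    comp h (comp g f) = comp (comp h g) f
}.

Notation "g \oc f" := (comp g f) (at level 40, left associativity).

Section Category.
Variable C : category.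
Implicit Types A B D P Q X Y Z : C.

Definition mono A B (f : hom A B) : Prop :=
  forall X (g h : hom X A), f \oc g = f \oc h -> g = h.

Definition epi A B (f : hom A B) : Prop :=
  forall X (g h : hom B X), g \oc f = h \oc f -> g = h.

Definition invertible A B (f : hom A B) : Prop :=
  exists g : hom B A, g \oc f = idm A /\ f \oc g = idm B.

Definition isomorphic A B : Prop := exists f : hom A B, invertible f.

Definition is_initial A : Prop := forall X, exists! f : hom A X, True.

Definition is_terminal A : Prop := forall X, exists! f : hom X A, True.

Definition is_zero A : Prop := is_initial A /\ is_terminal A.

(* The square
     P --p--> A
     |q       |f
     v        v
     B --g--> D
   is a pullback. *)
Definition is_pullback A B D P (f : hom A D) (g : hom B D)
    (p : hom P A) (q : hom P B) : Prop :=
  f \oc p = g \oc q /\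
  forall X (a : hom X A) (b : hom X B), f \oc a = g \oc b ->
    exists! u : hom X P, p \oc u = a /\ q \oc u = b.

Definition is_coequalizer A B Q (f g : hom A B) (q : hom B Q) : Prop :=
  q \oc f = q \oc g /\
  forall X (a : hom B X), a \oc f = a \oc g -> exists! u : hom Q X, u \oc q = a.

Definition regular_epi B D (e : hom B D) : Prop :=
  exists A (f g : hom A B), is_coequalizer f g e.

(* Finite limits are given by a terminal object and pullbacks. *)
Record is_regular : Prop := IsRegular {
  regular_terminal : exists A, is_terminal A;
  regular_pullback : forall A B D (f : hom A D) (g : hom B D),
    exists P (p : hom P A) (q : hom P B), is_pullback f g p q;
  regular_coequalizer : forall A B P (f : hom A B) (p q : hom P A),
    is_pullback f f p q -> exists Q (e : hom A Q), is_coequalizer p q e;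
  regular_stable : forall A B D P (f : hom A D) (g : hom B D)
      (p : hom P A) (q : hom P B),
    is_pullback f g p q -> regular_epi f -> regular_epi q
}.

End Category.

Record regularCategory := RegularCategory {
  regular_cat :> category;
  regular_ax : is_regular regular_cat
}.

Section Rank.
Variables (R : regularCategory) (r : R -> int).

Record rank_function : Prop := RankFunction {
  rank_bounded : exists m : int, forall A : R, m <= r A;
  rank_mono : forall (A B : R) (f : hom A B), mono f -> r A <= r B;
  rank_regular_epi : forall (B D : R) (e : hom B D),
    regular_epi e -> r D <= r B;
  rank_pullback : forall (A B C D : R) (f : hom A B) (g : hom C D)
      (e : hom A C) (e' : hom B D),
    mono f -> mono g -> regular_epi e -> regular_epi e' ->
    is_pullback e' g f e -> r D - r C <= r B - r A
}.

Definition strict : Prop :=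
  (forall (A B : R) (f : hom A B), mono f -> ~ invertible f -> r A < r B) /\
  (forall (B D : R) (e : hom B D),
     regular_epi e -> ~ invertible e -> r D < r B).

Definition zero_based : Prop := exists A : R, is_initial A /\ r A = 0.

(* Terminal objects and pullbacks are only unique up to isomorphism, so the
   formula is required for every choice of pt and of the fibers F i.  The sum
   over Hom(pt, D) is required to have finitely many nonzero terms:
   [\sum_(i \in _) _] is 0 otherwise. *)
Definition fiberwise : Prop :=
  forall (pt B D : R) (phi : hom B D) (F : {classic hom pt D} -> R)
      (p : forall i, hom (F i) B) (q : forall i, hom (F i) pt),
    is_terminal pt -> regular_epi phi ->
    (forall i, is_pullback phi (i : hom pt D) (p i) (q i)) ->
    finite_set [set i | r (F i) - r pt != 0] /\
    r B - r D = \sum_(i \in [set: {classic hom pt D}]) (r (F i) - r pt).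

End Rank.

(* Categories enriched in abelian groups.  The choiceType structure contained
   in a zmodType is available on any type by classical choice, so this is no
   restriction on the hom-sets. *)
Record preadditive := Preadditive {
  pobj : Type;
  phom : pobj -> pobj -> zmodType;
  pidm : forall A, phom A A;
  pcomp : forall A B C, phom B C -> phom A B -> phom A C;
  pcomp1m : forall A B (f : phom A B), pcomp (pidm B) f = f;
  pcompm1 : forall A B (f : phom A B), pcomp f (pidm A) = f;
  pcompA : forall A B C D (h : phom C D) (g : phom B C) (f : phom A B),
    pcomp h (pcomp g f) = pcomp (pcomp h g) f;
  pcompDl : forall A B C (g h : phom B C) (f : phom A B),
    pcomp (g + h) f = pcomp g f + pcomp h f;
  pcompDr : forall A B C (g : phom B C) (f h : phom A B),
    pcomp g (f + h) = pcomp g f + pcomp g h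
}.

Definition preadditive_cat (V : preadditive) : category :=
  @Category (pobj V) (fun A B => phom A B) (@pidm V) (@pcomp V)
    (@pcomp1m V) (@pcompm1 V) (@pcompA V).
Coercion preadditive_cat : preadditive >-> category.

Section Preadditive.
Variable V : preadditive.
Implicit Types A B K Q S X : V.

Definition is_kernel K A B (f : phom A B) (k : phom K A) : Prop :=
  pcomp f k = 0 /\
  forall X (a : phom X A), pcomp f a = 0 -> exists! u : phom X K, pcomp k u = a.

Definition is_cokernel A B Q (f : phom A B) (q : phom B Q) : Prop :=
  pcomp q f = 0 /\
  forall X (a : phom B X), pcomp a f = 0 -> exists! u : phom Q X, pcomp u q = a.

Definition is_biproduct A B S (iA : phom A S) (iB : phom B S)
    (pA : phom S A) (pB : phom S B) : Prop :=
  [/\ pcomp pA iA = pidm A, pcomp pB iB = pidm B, pcomp pB iA = 0,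
      pcomp pA iB = 0 & pcomp iA pA + pcomp iB pB = pidm S].

Record is_abelian : Prop := IsAbelian {
  abelian_zero : exists A, is_zero A;
  abelian_biproduct : forall A B, exists S (iA : phom A S) (iB : phom B S)
    (pA : phom S A) (pB : phom S B), is_biproduct iA iB pA pB;
  abelian_kernel : forall A B (f : phom A B),
    exists K (k : phom K A), is_kernel f k;
  abelian_cokernel : forall A B (f : phom A B),
    exists Q (q : phom B Q), is_cokernel f q;
  abelian_mono : forall A B (f : hom A B), mono f ->
    exists Q (g : phom B Q), is_kernel g f;
  abelian_epi : forall A B (f : hom A B), epi f ->
    exists K (g : phom K A), is_cokernel g f
}.

End Preadditive.

Record abelianCategory := AbelianCategory {
  abelian_pre :> preadditive;
  abelian_ax : is_abelian abelian_pre
}.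

Section PreadditiveTheory.
Variable V : preadditive.
Implicit Types A B C : V.

Lemma pcomp0m A B C (f : phom A B) : pcomp (0 : phom B C) f = 0.
Proof. by apply: (addrI (pcomp 0 f)); rewrite -pcompDl !addr0. Qed.

Lemma pcompm0 A B C (g : phom B C) : pcomp g (0 : phom A B) = 0.
Proof. by apply: (addrI (pcomp g 0)); rewrite -pcompDr !addr0. Qed.

Lemma pcompNm A B C (g : phom B C) (f : phom A B) :
  pcomp (- g) f = - pcomp g f.
Proof. by apply: (addrI (pcomp g f)); rewrite -pcompDl !subrr pcomp0m. Qed.

Lemma pcompmN A B C (g : phom B C) (f : phom A B) :
  pcomp g (- f) = - pcomp g f.
Proof. by apply: (addrI (pcomp g f)); rewrite -pcompDr !subrr pcompm0. Qed.

Lemma pcompBl A B C (g h : phom B C) (f : phom A B) :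
  pcomp (g - h) f = pcomp g f - pcomp h f.
Proof. by rewrite pcompDl pcompNm. Qed.

Lemma pcompBr A B C (g : phom B C) (f h : phom A B) :
  pcomp g (f - h) = pcomp g f - pcomp g h.
Proof. by rewrite pcompDr pcompmN. Qed.

Lemma epi0P A B (f : phom A B) :
  (forall X (h : phom B X), pcomp h f = 0 -> h = 0) -> epi (C := V) f.
Proof.
move=> fP X g h /= gh; apply/eqP; rewrite -subr_eq0; apply/eqP/fP.
by rewrite pcompBl gh subrr.
Qed.

Lemma regular_epi_epi (C : category) (A B : C) (e : hom A B) :
  regular_epi e -> epi e.
Proof.
move=> [K [f [g [efg uniq]]]] X a b ab.
have [|u [_ uP]] := uniq X (a \oc e); first by rewrite -!compA efg.
by rewrite -(uP a erefl) -(uP b (esym ab)).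
Qed.

Lemma coequalizer_cokernel A B Q (f g : phom A B) (q : phom B Q) :
  is_cokernel (f - g) q -> is_coequalizer (C := V) f g q.
Proof.
move=> [q0 qP]; split=> [|X a afg] /=.
  by apply/eqP; rewrite -subr_eq0 -pcompBr q0.
by apply: qP; rewrite pcompBr; apply/eqP; rewrite subr_eq0; apply/eqP.
Qed.

End PreadditiveTheory.

Section AbelianRegular.
Variable V : abelianCategory.
Implicit Types A B D P Q S X : V.

Lemma abelian_regular_epi A B (f : hom A B) : epi f -> regular_epi (C := V) f.
Proof.
move=> /(abelian_epi (abelian_ax V)) [K [g gP]].
exists K, g, 0; apply: coequalizer_cokernel; by rewrite subr0.
Qed.

Lemma biproduct_epi A B D S (f : phom A D) (g : phom B D) (iA : phom A S)
    (iB : phom B S) (pA : phom S A) (pB : phom S B) :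
  is_biproduct iA iB pA pB -> epi (C := V) f ->
  epi (C := V) (pcomp f pA - pcomp g pB).
Proof.
move=> [pAiA _ pBiA _ _] fepi; apply: epi0P => X h h0.
apply: fepi; rewrite /= pcomp0m; move: (congr1 (fun u => pcomp u iA) h0).
by rewrite pcomp0m -pcompA pcompBl -!pcompA pAiA pBiA pcompm0 subr0 pcompm1.
Qed.

Lemma pullback_epi A B D P (f : hom A D) (g : hom B D)
    (p : hom P A) (q : hom P B) :
  is_pullback (C := V) f g p q -> epi f -> epi q.
Proof.
move=> [_ univ] fepi; apply: epi0P => Z h hq.
have [S [iA [iB [pA [pB bi]]]]] := abelian_biproduct (abelian_ax V) A B.
have eepi := biproduct_epi (g := g) bi fepi.
case: (bi) => [pAiA pBiB pBiA pAiB _].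
have [K [k [ek euniv]]] := abelian_epi (abelian_ax V) eepi.
have : pcomp f (pcomp pA k) = pcomp g (pcomp pB k).
  by apply/eqP; rewrite -subr_eq0 !pcompA -pcompBl ek.
move=> /univ [w [[_ qw] _]].
have [|v [vP _]] := euniv Z (pcomp h pB).
  by rewrite -pcompA -qw /= pcompA hq pcomp0m.
have v0 : v = 0.
  apply: fepi; rewrite /= pcomp0m; move: (congr1 (fun u => pcomp u iA) vP).
  rewrite -!pcompA pBiA pcompm0 pcompBl -!pcompA pAiA pBiA pcompm0 subr0.
  by rewrite pcompm1.
move: (congr1 (fun u => pcomp u iB) vP).
by rewrite v0 !pcomp0m -pcompA pBiB pcompm1.
Qed.

Lemma abelian_pullback A B D (f : hom A D) (g : hom B D) :
  exists P (p : hom P A) (q : hom P B), is_pullback (C := V) f g p q.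
Proof.
have [S [iA [iB [pA [pB bi]]]]] := abelian_biproduct (abelian_ax V) A B.
case: bi => [pAiA pBiB pBiA pAiB id1].
have [P [k [ek kP]]] :=
  abelian_kernel (abelian_ax V) (pcomp f pA - pcomp g pB).
exists P, (pcomp pA k), (pcomp pB k); split=> [|X a b /= ab].
  by apply/eqP; rewrite -subr_eq0 /= !pcompA -pcompBl ek.
have [|u [uP uU]] := kP X (pcomp iA a + pcomp iB b).
  rewrite pcompBl !pcompDr -!pcompA !(pcompA pA) !(pcompA pB).
  rewrite pAiA pBiB pBiA pAiB !pcomp0m !pcomp1m !pcompm0 addr0 add0r ab.
  exact: subrr.
exists u; split=> [|v [/= va vb]]; last first.
  by apply: uU; rewrite -va -vb -!pcompA !(pcompA iA) !(pcompA iB) -pcompDl id1 pcomp1m.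
rewrite /= -!pcompA uP !pcompDr !pcompA pAiA pBiB pBiA pAiB.
by rewrite !pcomp0m !pcomp1m addr0 add0r.
Qed.

Lemma abelian_is_regular : is_regular V.
Proof.
split.
- by have [Z [_ Zt]] := abelian_zero (abelian_ax V); exists Z.
- exact: abelian_pullback.
- move=> A B P f p q _.
  have [Q [e eP]] := abelian_cokernel (abelian_ax V) (p - q : phom P A).
  by exists Q, e; apply: coequalizer_cokernel.
- move=> A B D P f g p q pb /regular_epi_epi fe.
  exact/abelian_regular_epi/(pullback_epi pb fe).
Qed.

Definition abelian_regular : regularCategory :=
  RegularCategory abelian_is_regular.

Definition simple X : Prop :=
  ~ is_zero X /\
  forall A (m : hom A X), mono m -> is_zero A \/ invertible m.

(* X_0 = S 0, ..., X_n = S n; the values of S and f beyond n play no role. *)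
Definition has_length X (n : nat) : Prop :=
  exists (S : nat -> V) (f : forall k, hom (S k) (S k.+1)),
    [/\ is_zero (S 0%N), isomorphic (S n) X &
        forall k, (k < n)%N -> mono (f k) /\
          exists Q (q : phom (S k.+1) Q), is_cokernel (f k) q /\ simple Q].

Definition finite_length : Prop := forall X, exists n, has_length X n.

(* By Jordan-Hölder, at most one n satisfies has_length X n. *)
Definition length X : nat := xget 0%N [set n | has_length X n].

End AbelianRegular.

(* Main.v *)
From mathcomp Require Import all_boot all_order all_algebra.
From mathcomp Require Import boolp classical_sets cardinality fsbigop.
Require Import Defs.

(** Length is additive on short exact sequences [0 -> A -> B -> C -> 0].  A
    composition series of [C] is pulled back to [B] and glued on top of one of
    [A]; conversely a composition series of [B] is intersected with [A] and
    projected to [C], each simple factor surviving on exactly one side.  The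
    converse splitting, applied to a maximal proper subobject, also gives
    uniqueness of the length by induction.
    Everything else is additivity: a pullback of an epimorphism has the same
    kernel, so condition (3) is an equality, and the sum over [Hom(pt, D)] has
    the single term [length (ker phi)]. *)

Set Implicit Arguments.
Unset Strict Implicit.
Unset Printing Implicit Defensive.

Import Order.TTheory GRing.Theory Num.Theory.
Local Open Scope ring_scope.
Local Open Scope classical_set_scope.

(** * Monos, epis, zero objects, kernels and cokernels in a preadditive category *)

Section Kernels.
Variable V : preadditive.
Implicit Types A B C K Q X : V.

Lemma mono0P A B (f : phom A B) :
  (forall X (h : phom X A), pcomp f h = 0 -> h = 0) -> mono (C := V) f.
Proof.
move=> fP X g h /= gh; apply/eqP; rewrite -subr_eq0; apply/eqP/fP.
by rewrite pcompBr gh subrr.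
Qed.

Lemma mono_eq0 A B (f : phom A B) X (h : phom X A) :
  mono (C := V) f -> pcomp f h = 0 -> h = 0.
Proof. by move=> fm fh; apply: fm; rewrite /= pcompm0. Qed.

Lemma epi_eq0 A B (f : phom A B) X (h : phom B X) :
  epi (C := V) f -> pcomp h f = 0 -> h = 0.
Proof. by move=> fe hf; apply: fe; rewrite /= pcomp0m. Qed.

(** Being zero becomes an equation between morphisms, which can be tested after cancelling a mono or
    an epi. *)
Lemma is_zeroP X : is_zero (C := V) X <-> pidm X = 0.
Proof.
split=> [[Xi _]|X0].
  by have [f [_ fU]] := Xi X; rewrite -(fU (pidm X) I) -(fU 0 I).
split=> Y; exists 0; split=> // f _.
  by rewrite -[f in RHS]pcompm1 X0 pcompm0.
by rewrite -[f in RHS]pcomp1m X0 pcomp0m.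
Qed.

Lemma to_zero_eq0 X Z (f : phom X Z) : is_zero (C := V) Z -> f = 0.
Proof. by move=> /is_zeroP Z0; rewrite -[f]pcomp1m Z0 pcomp0m. Qed.

Lemma from_zero_eq0 X Z (f : phom Z X) : is_zero (C := V) Z -> f = 0.
Proof. by move=> /is_zeroP Z0; rewrite -[f]pcompm1 Z0 pcompm0. Qed.

Lemma mono_zero A B (f : phom A B) :
  mono (C := V) f -> is_zero (C := V) B -> is_zero (C := V) A.
Proof. by move=> fm B0; apply/is_zeroP/(mono_eq0 fm)/to_zero_eq0. Qed.

Lemma epi_zero A B (f : phom A B) :
  epi (C := V) f -> is_zero (C := V) A -> is_zero (C := V) B.
Proof. by move=> fe A0; apply/is_zeroP/(epi_eq0 fe)/from_zero_eq0. Qed.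

Lemma mono_comp A B C (g : phom B C) (f : phom A B) :
  mono (C := V) g -> mono (C := V) f -> mono (C := V) (pcomp g f).
Proof. by move=> gm fm X a b /=; rewrite -!pcompA => /gm /fm. Qed.

Lemma epi_comp A B C (g : phom B C) (f : phom A B) :
  epi (C := V) g -> epi (C := V) f -> epi (C := V) (pcomp g f).
Proof. by move=> ge fe X a b /=; rewrite !pcompA => /fe /ge. Qed.

Lemma mono_factor A B C (g : phom B C) (f : phom A B) :
  mono (C := V) (pcomp g f) -> mono (C := V) f.
Proof. by move=> gfm X a b /= ab; apply: gfm; rewrite /= -!pcompA ab. Qed.

Lemma epi_factor A B C (g : phom B C) (f : phom A B) :
  epi (C := V) (pcomp g f) -> epi (C := V) g.
Proof. by move=> gfe X a b /= ab; apply: gfe; rewrite /= !pcompA ab. Qed.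

Lemma invertible_mono A B (f : phom A B) :
  invertible (C := V) f -> mono (C := V) f.
Proof.
move=> [g [/= gf _]] X a b /= ab.
by rewrite -[a]pcomp1m -[b]pcomp1m -gf -!pcompA ab.
Qed.

Lemma invertible_epi A B (f : phom A B) :
  invertible (C := V) f -> epi (C := V) f.
Proof.
move=> [g [/= _ fg]] X a b /= ab.
by rewrite -[a]pcompm1 -[b]pcompm1 -fg !pcompA ab.
Qed.

Lemma is_kernelI K A B (f : phom A B) (k : phom K A) :
  mono (C := V) k -> pcomp f k = 0 ->
  (forall X (a : phom X A), pcomp f a = 0 -> exists u : phom X K, pcomp k u = a) ->
  is_kernel f k.
Proof.
move=> km fk kP; split=> // X a /kP [u ku]; exists u; split=> // v kv.
by apply: km; rewrite /= ku kv.
Qed.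

Lemma is_cokernelI A B Q (f : phom A B) (q : phom B Q) :
  epi (C := V) q -> pcomp q f = 0 ->
  (forall X (a : phom B X), pcomp a f = 0 -> exists u : phom Q X, pcomp u q = a) ->
  is_cokernel f q.
Proof.
move=> qe qf qP; split=> // X a /qP [u uq]; exists u; split=> // v vq.
by apply: qe; rewrite /= uq vq.
Qed.

Lemma kernel_lift K A B (f : phom A B) (k : phom K A) X (a : phom X A) :
  is_kernel f k -> pcomp f a = 0 -> exists u : phom X K, pcomp k u = a.
Proof. by move=> [_ kP] /kP [u [ku _]]; exists u. Qed.

Lemma cokernel_desc A B Q (f : phom A B) (q : phom B Q) X (a : phom B X) :
  is_cokernel f q -> pcomp a f = 0 -> exists u : phom Q X, pcomp u q = a.
Proof. by move=> [_ qP] /qP [u [uq _]]; exists u. Qed.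

Lemma kernel_mono K A B (f : phom A B) (k : phom K A) :
  is_kernel f k -> mono (C := V) k.
Proof.
move=> [fk kP]; apply: mono0P => X h kh.
have [|u [_ uU]] := kP X 0; first by rewrite pcompm0.
by rewrite -(uU h kh) -(uU 0) // pcompm0.
Qed.

Lemma cokernel_epi A B Q (f : phom A B) (q : phom B Q) :
  is_cokernel f q -> epi (C := V) q.
Proof.
move=> [qf qP]; apply: epi0P => X h hq.
have [|u [_ uU]] := qP X 0; first by rewrite pcomp0m.
by rewrite -(uU h hq) -(uU 0) // pcomp0m.
Qed.

End Kernels.

(** * Short exact sequences and the isomorphism theorems *)

Section ShortExact.
Variable V : abelianCategory.
Implicit Types A B C K Q S X : V.

(** [f] is the kernel of some [g], and [g] factors through the cokernel [q]; so whatever [q] kills,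
    [g] kills too, and it lifts through [f]. *)
Lemma mono_kernel A B Q (f : phom A B) (q : phom B Q) :
  mono (C := V) f -> is_cokernel f q -> is_kernel q f.
Proof.
move=> fm qP; have [R [g gP]] := abelian_mono (abelian_ax V) fm.
have [u uq] := cokernel_desc qP (proj1 gP).
apply: is_kernelI => // [|X a qa]; first exact: (proj1 qP).
by apply: (kernel_lift gP); rewrite -uq -pcompA qa pcompm0.
Qed.

Lemma epi_cokernel K A B (f : phom A B) (k : phom K A) :
  epi (C := V) f -> is_kernel f k -> is_cokernel k f.
Proof.
move=> fe kP; have [R [g gP]] := abelian_epi (abelian_ax V) fe.
have [u ku] := kernel_lift kP (proj1 gP).
apply: is_cokernelI => // [|X a ak]; first exact: (proj1 kP).
by apply: (cokernel_desc gP); rewrite -ku pcompA ak pcomp0m.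
Qed.

(** [f] is the kernel of some [g]; as [f] is epi, [g] vanishes, so the identity of [B] lifts through
    [f]. *)
Lemma mono_epi_invertible A B (f : phom A B) :
  mono (C := V) f -> epi (C := V) f -> invertible (C := V) f.
Proof.
move=> fm fe; have [R [g gP]] := abelian_mono (abelian_ax V) fm.
have g0 := epi_eq0 fe (proj1 gP).
have [|u fu] := kernel_lift (a := pidm B) gP; first by rewrite pcompm1.
exists u; split=> //=; apply: fm.
by rewrite /= pcompA fu pcomp1m pcompm1.
Qed.

(** The image of [f], built as the kernel of its cokernel, is a nonzero subobject of [S], hence all
    of [S]; so the cokernel map vanishes. *)
Lemma simple_epi A S (f : phom A S) :
  simple (V := V) S -> f <> 0 -> epi (C := V) f.
Proof.
move=> [_ Ss] f0.
have [Q [c cP]] := abelian_cokernel (abelian_ax V) f.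
have [I [m mP]] := abelian_kernel (abelian_ax V) c.
have [u mu] := kernel_lift mP (proj1 cP).
have [I0|mi] := Ss _ _ (kernel_mono mP).
  by case: f0; rewrite -mu (to_zero_eq0 u I0) pcompm0.
have c0 := epi_eq0 (invertible_epi mi) (proj1 mP).
apply: epi0P => X h /(cokernel_desc cP) [v <-].
by rewrite c0 pcompm0.
Qed.

Definition short_exact A B C (i : phom A B) (p : phom B C) : Prop :=
  [/\ mono (C := V) i, epi (C := V) p & is_kernel p i].

Lemma short_exact_cokernel A B C (i : phom A B) (p : phom B C) :
  mono (C := V) i -> is_cokernel i p -> short_exact i p.
Proof. by move=> im ip; split=> //; [apply: cokernel_epi ip | apply: mono_kernel]. Qed.

Lemma short_exact_kernel A B C (i : phom A B) (p : phom B C) :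
  epi (C := V) p -> is_kernel p i -> short_exact i p.
Proof. by move=> pe ip; split=> //; apply: kernel_mono ip. Qed.

Lemma short_exact_is_cokernel A B C (i : phom A B) (p : phom B C) :
  short_exact i p -> is_cokernel i p.
Proof. by move=> [_ pe ip]; apply: epi_cokernel. Qed.

Lemma short_exact_zero_l A B C (i : phom A B) (p : phom B C) :
  short_exact i p -> is_zero (C := V) A -> invertible (C := V) p.
Proof.
move=> [im pe ip] A0; apply: mono_epi_invertible => //.
apply: mono0P => X h /(kernel_lift ip) [u <-].
by rewrite (to_zero_eq0 u A0) pcompm0.
Qed.

Lemma short_exact_zero_r A B C (i : phom A B) (p : phom B C) :
  short_exact i p -> is_zero (C := V) C -> invertible (C := V) i.
Proof.
move=> ip C0; have [im _ _] := ip; apply: mono_epi_invertible => //.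
apply: epi0P => X h /(cokernel_desc (short_exact_is_cokernel ip)) [u <-].
by rewrite (from_zero_eq0 u C0) pcomp0m.
Qed.

(** [B'] is the preimage of [C'] under [p], obtained as the kernel of [s p]. It contains [A] and has
    the same quotient [S] as [C']. *)
Lemma short_exact_preimage A B C C' S (i : phom A B) (p : phom B C)
    (m : phom C' C) (s : phom C S) :
  short_exact i p -> short_exact m s ->
  exists B' (k : phom B' B) (j : phom A B') (p' : phom B' C'),
    short_exact k (pcomp s p) /\ short_exact j p'.
Proof.
move=> [im pe ip] [mm se ms].
have [B' [k kP]] := abelian_kernel (abelian_ax V) (pcomp s p).
have km := kernel_mono kP.
have [|j kj] := kernel_lift (a := i) kP.
  by rewrite -pcompA (proj1 ip) pcompm0.
have [|p' mp'] := kernel_lift (a := pcomp p k) ms.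
  by rewrite pcompA (proj1 kP).
exists B', k, j, p'; split; first exact: short_exact_kernel (epi_comp se pe) kP.
have jm : mono (C := V) j by apply: (mono_factor (g := k)); rewrite kj.
(* Seeing [B'] as the pullback of [p] along [m] makes [p'] epi, since epis are stable under
   pullback. *)
have pb : is_pullback (C := V) p m k p'.
  split=> [|X x y /= xy]; first exact: esym mp'.
  have [|u ku] := kernel_lift (a := x) kP.
    by rewrite -pcompA xy pcompA (proj1 ms) pcomp0m.
  exists u; split=> [|v [/= kv _]]; last by apply: km; rewrite /= kv.
  by split=> //=; apply: mm; rewrite /= pcompA mp' -pcompA ku.
apply: short_exact_kernel; first exact: pullback_epi pb pe.
apply: is_kernelI => // [|X x p'x].
  by apply: (mono_eq0 mm); rewrite pcompA mp' -pcompA kj (proj1 ip).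
have [|t it] := kernel_lift (a := pcomp k x) ip.
  by rewrite pcompA -mp' -pcompA p'x pcompm0.
by exists t; apply: km; rewrite /= pcompA kj.
Qed.

(** Third isomorphism theorem: [q i = 0] says that [A] lies in [B'], and with [C' = B'/A] the
    quotient of [C] by [C'] is again [S]. *)
Lemma short_exact_quotient A B C B' S (i : phom A B) (p : phom B C)
    (k : phom B' B) (q : phom B S) :
  short_exact i p -> short_exact k q -> pcomp q i = 0 ->
  exists (j : phom A B') C' (p' : phom B' C') (m : phom C' C) (s : phom C S),
    short_exact j p' /\ short_exact m s.
Proof.
move=> ip kq qi; have [im pe ipk] := ip; have [km qe kqk] := kq.
have [j kj] := kernel_lift kqk qi.
have jm : mono (C := V) j by apply: (mono_factor (g := k)); rewrite kj.
have [C' [p' p'P]] := abelian_cokernel (abelian_ax V) j.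
have p'e := cokernel_epi p'P.
have [|m mp'] := cokernel_desc (a := pcomp p k) p'P.
  by rewrite -pcompA kj (proj1 ipk).
have [s sp] := cokernel_desc (short_exact_is_cokernel ip) qi.
exists j, C', p', m, s; split; first exact: short_exact_cokernel.
have se : epi (C := V) s by apply: (epi_factor (f := p)); rewrite sp.
apply: short_exact_cokernel.
  apply: mono0P => X x mx.
  (* To show that [m] is mono, an [x] killed by [m] is lifted along [p'] after passing to the epi
     cover [e]. The lift [y] is killed by [p k], so it comes from [A], which [p'] kills. *)
  have [Y [y [e pb]]] := abelian_pullback (V := V) p' x.
  have ee := pullback_epi pb p'e; have [/= p'y _] := pb.
  have [|t it] := kernel_lift (a := pcomp k y) ipk.
    by rewrite pcompA -mp' -pcompA p'y pcompA mx pcomp0m.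
  have yj : y = pcomp j t by apply: km; rewrite /= pcompA kj.
  apply: (epi_eq0 ee).
  by rewrite -p'y yj pcompA (proj1 p'P) pcomp0m.
apply: is_cokernelI => // [|X h hm].
  apply: (epi_eq0 p'e).
  by rewrite -pcompA mp' pcompA sp (proj1 kqk).
(* [h p] kills [B'], so it factors through [q = s p]; cancelling [p] makes [h] factor through
   [s]. *)
have [|u uq] := cokernel_desc (a := pcomp h p) (short_exact_is_cokernel kq).
  by rewrite -pcompA -mp' pcompA hm pcomp0m.
by exists u; apply: pe; rewrite /= -pcompA sp.
Qed.

(** Second isomorphism theorem: [q i] being epi says that [A] and [B'] together span [B]. With [A']
    their intersection, [A/A'] is [S] and [B'/A'] is [C]. *)
Lemma short_exact_modular A B C B' S (i : phom A B) (p : phom B C)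
    (k : phom B' B) (q : phom B S) :
  short_exact i p -> short_exact k q -> epi (C := V) (pcomp q i) ->
  exists A' (a : phom A' A) (b : phom A' B'),
    short_exact a (pcomp q i) /\ short_exact b (pcomp p k).
Proof.
move=> ip kq qie; have [im pe ipk] := ip; have [km qe kqk] := kq.
have [A' [a aP]] := abelian_kernel (abelian_ax V) (pcomp q i).
have am := kernel_mono aP.
have [|b kb] := kernel_lift (a := pcomp i a) kqk.
  by rewrite pcompA (proj1 aP).
have bm : mono (C := V) b.
  by apply: (mono_factor (g := k)); rewrite kb; apply: mono_comp.
exists A', a, b; split; first exact: short_exact_kernel.
apply: short_exact_kernel.
  (* If [h] kills [p k], then [h p = u q] for some [u]. Restricting to [A] gives [u q i = 0], so
     [u = 0], and then [h = 0] because [p] is epi. *)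
  apply: epi0P => X h; rewrite pcompA.
  move=> /(cokernel_desc (short_exact_is_cokernel kq)) [u uq].
  apply: (epi_eq0 pe); rewrite -uq (epi_eq0 (h := u) qie) ?pcomp0m //.
  by rewrite pcompA uq -pcompA (proj1 ipk) pcompm0.
apply: is_kernelI => // [|X x pkx].
  by rewrite -pcompA kb pcompA (proj1 ipk) pcomp0m.
have [|t it] := kernel_lift (a := pcomp k x) ipk; first by rewrite pcompA.
have [|w aw] := kernel_lift (a := t) aP.
  by rewrite -pcompA it pcompA (proj1 kqk) pcomp0m.
by exists w; apply: km; rewrite /= pcompA kb -pcompA aw.
Qed.

End ShortExact.

(** * Composition series, additivity and uniqueness of the length *)

Section Length.
Variable V : abelianCategory.
Implicit Types A B C S X Y Z : V.

Definition maximal_sub A B : Prop :=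
  exists (f : phom A B) S (q : phom B S), short_exact f q /\ simple (V := V) S.

Lemma isomorphic_trans X Y Z : isomorphic (C := V) X Y ->
  isomorphic (C := V) Y Z -> isomorphic (C := V) X Z.
Proof.
move=> [f [f' [/= f'f ff']]] [g [g' [/= g'g gg']]].
exists (pcomp g f), (pcomp f' g'); split=> /=.
  by rewrite -pcompA (pcompA g') g'g pcomp1m.
by rewrite -pcompA (pcompA f) ff' pcomp1m.
Qed.

Lemma isomorphic_zero X Y :
  isomorphic (C := V) X Y -> is_zero (C := V) X -> is_zero (C := V) Y.
Proof. by move=> [f /invertible_epi fe]; apply: epi_zero fe. Qed.

Lemma maximal_sub_iso A A' B B' : isomorphic (C := V) A' A ->
  isomorphic (C := V) B B' -> maximal_sub A B -> maximal_sub A' B'.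
Proof.
move=> [a ai] [b bi] [f [S [q [fq Ss]]]].
have [b' [/= b'b bb']] := bi; have [fm qe fk] := fq.
have [a' [/= a'a aa']] := ai.
have b'i : invertible (C := V) b' by exists b.
exists (pcomp b (pcomp f a)), S, (pcomp q b'); split=> //.
apply: short_exact_kernel; first exact: epi_comp qe (invertible_epi b'i).
apply: is_kernelI.
- exact: mono_comp (invertible_mono bi) (mono_comp fm (invertible_mono ai)).
- rewrite -pcompA (pcompA b') b'b pcomp1m pcompA (proj1 fk).
  exact: pcomp0m.
- move=> X x; rewrite -pcompA => /(kernel_lift fk) [u fu].
  exists (pcomp a' u).
  by rewrite -!pcompA (pcompA a) aa' pcomp1m fu pcompA bb' pcomp1m.
Qed.

(** Hides the chosen maps and cokernels of a series, so that series can be cut and extended by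
    handling only the sequence of objects. *)
Lemma has_lengthP X n : has_length (V := V) X n <->
  exists S : nat -> V, [/\ is_zero (C := V) (S 0%N), isomorphic (C := V) (S n) X &
    forall k, (k < n)%N -> maximal_sub (S k) (S k.+1)].
Proof.
split=> [[S [f [S0 SX fP]]]|[S [S0 SX SP]]].
  exists S; split=> // k /fP [fm [Q [q [fq Qs]]]].
  by exists (f k), Q, q; split=> //; apply: short_exact_cokernel.
have /(_ _)/cid fP : forall k, exists f : hom (S k) (S k.+1), (k < n)%N ->
    mono (C := V) f /\
    exists Q (q : phom (S k.+1) Q), is_cokernel f q /\ simple (V := V) Q.
  (* A map is required at every index; from [n] on the zero map is the default. *)
  move=> k; have [/SP|_] := boolP (k < n)%N; last by exists (0 : phom _ _).
  move=> [f [Q [q [fq Qs]]]]; exists f => _.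
  have [fm _ _] := fq; split=> //.
  by exists Q, q; split=> //; apply: short_exact_is_cokernel.
exists S, (fun k => sval (fP k)); split=> // k; exact: (svalP (fP k)).
Qed.

Lemma has_length0 X : has_length (V := V) X 0 <-> is_zero (C := V) X.
Proof.
rewrite has_lengthP; split=> [[S [S0 SX _]]|X0].
  exact: isomorphic_zero SX S0.
exists (fun _ => X); split=> //.
by exists (pidm X), (pidm X); rewrite /= pcomp1m.
Qed.

(** Together with [has_length0] this gives a recursive description of length, peeling off the top
    factor, on which all later inductions run. *)
Lemma has_lengthS X n : has_length (V := V) X n.+1 <->
  exists2 Y : V, maximal_sub Y X & has_length (V := V) Y n.
Proof.
split=> [/has_lengthP [S [S0 SX SP]]|[Y YX /has_lengthP [S [S0 SY SP]]]].
  have idi : isomorphic (C := V) (S n) (S n).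
    by exists (pidm _), (pidm _); rewrite /= pcomp1m.
  exists (S n); first exact: maximal_sub_iso idi SX (SP _ _).
  by apply/has_lengthP; exists S; split=> // k kn; apply/SP/ltnW.
have idi : isomorphic (C := V) X X.
  by exists (pidm X), (pidm X); rewrite /= pcomp1m.
(* The series of [Y] fills the indices up to [n] and [X] sits at [n.+1]. The top link is
   transported, as [S n] is only isomorphic to [Y]. *)
apply/has_lengthP; exists (fun k => if (k <= n)%N then S k else X); split=> //.
  by rewrite ltnn.
move=> k; rewrite ltnS => kn; rewrite kn; case: ltnP => [/SP //|nk].
have -> : k = n by apply/eqP; rewrite eqn_leq kn.
exact: maximal_sub_iso SY idi YX.
Qed.

Lemma has_length_iso X Y n : isomorphic (C := V) X Y ->
  has_length (V := V) X n -> has_length (V := V) Y n.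
Proof.
move=> XY /has_lengthP [S [S0 SX SP]]; apply/has_lengthP; exists S; split=> //.
exact: isomorphic_trans SX XY.
Qed.

Lemma has_length_extension A B C (i : phom A B) (p : phom B C) a c :
  short_exact i p -> has_length (V := V) A a -> has_length (V := V) C c ->
  has_length (V := V) B (a + c).
Proof.
elim: c => [|c IHc] in B C i p * => ip Aa.
  move=> /has_length0 /(short_exact_zero_r ip) ii.
  by rewrite addn0; apply: has_length_iso Aa; exists i.
move=> /has_lengthS [C' [m [S [s [ms Ss]]]] C'c].
(* The preimage of the maximal subobject [C'] of [C] is maximal in [B], and it is an extension of
   [C'] by [A]. *)
have [B' [k [j [p' [ksp jp']]]]] := short_exact_preimage ip ms.
rewrite addnS; apply/has_lengthS; exists B'; last exact: IHc jp' Aa C'c.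
by exists k, S, (pcomp s p).
Qed.

Lemma has_length_split A B C (i : phom A B) (p : phom B C) n :
  short_exact i p -> has_length (V := V) B n ->
  exists a c, [/\ has_length (V := V) A a, has_length (V := V) C c &
    (a + c = n)%N].
Proof.
elim: n => [|n IHn] in A B C i p * => ip.
  have [im pe _] := ip; move=> /has_length0 B0; exists 0%N, 0%N; split=> //.
    exact/has_length0/(mono_zero im).
  exact/has_length0/(epi_zero pe).
move=> /has_lengthS [B' [k [S [q [kq Ss]]]] B'n].
(* Since [S] is simple, either [A] lies in [B'] and the factor [S] is counted in [C], or [A] maps
   onto [S] and the factor is counted in [A]. *)
have [qi|/(simple_epi Ss) qie] := pselect (pcomp q i = 0).
  have [j [C' [p' [m [s [jp' ms]]]]]] := short_exact_quotient ip kq qi.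
  have [a [c [Aa C'c <-]]] := IHn _ _ _ _ _ jp' B'n.
  exists a, c.+1; rewrite addnS; split=> //.
  by apply/has_lengthS; exists C' => //; exists m, S, s.
have [A' [a [b [aqi bpk]]]] := short_exact_modular ip kq qie.
have [n1 [n2 [A'n Cn <-]]] := IHn _ _ _ _ _ bpk B'n.
exists n1.+1, n2; split=> //.
by apply/has_lengthS; exists A' => //; exists a, S, (pcomp q i).
Qed.

Lemma has_length_zero X n :
  is_zero (C := V) X -> has_length (V := V) X n -> n = 0%N.
Proof.
case: n => // n X0 /has_lengthS [Y [f [S [q [[_ qe _] [S0 _]]]]] _].
by case: S0; apply: epi_zero qe X0.
Qed.

Lemma has_length_simple S n :
  simple (V := V) S -> has_length (V := V) S n -> n = 1%N.
Proof.
move=> [S0 Ss]; case: n => [/has_length0 //|n].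
move=> /has_lengthS [Y [f [T [q [[fm qe fk] [T0 _]]]]] Yn].
(* The maximal subobject [Y] is zero or all of [S]; the latter would make the simple quotient [T]
   zero. *)
have [Y0|fi] := Ss _ _ fm; first by rewrite (has_length_zero Y0 Yn).
have q0 := epi_eq0 (invertible_epi fi) (proj1 fk).
by case: T0; apply/is_zeroP/(epi_eq0 qe); rewrite q0 pcompm0.
Qed.

Lemma has_length_unique X n m :
  has_length (V := V) X n -> has_length (V := V) X m -> n = m.
Proof.
elim: n => [|n IHn] in X m *.
  by move=> /has_length0 X0 /(has_length_zero X0).
move=> /has_lengthS [Y [f [S [q [fq Ss]]]] Yn] Xm.
(* The second series is split along the maximal subobject [Y] of the first; the part over the simple
   quotient has length one. *)
have [a [c [Ya Sc <-]]] := has_length_split fq Xm.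
by rewrite (has_length_simple Ss Sc) addn1 (IHn _ _ Yn Ya).
Qed.

Lemma has_length_length X n : has_length (V := V) X n -> length (V := V) X = n.
Proof.
move=> Xn; apply: (has_length_unique (X := X)) => //.
exact: (@xgetPex _ 0%N [set n | has_length (V := V) X n]) (ex_intro _ n Xn).
Qed.

Lemma length_short_exact A B C (i : phom A B) (p : phom B C) :
  finite_length V -> short_exact i p ->
  length (V := V) B = (length (V := V) A + length (V := V) C)%N.
Proof.
move=> fl ip; have [[a Aa] [c Cc]] := (fl A, fl C).
rewrite (has_length_length (has_length_extension ip Aa Cc)).
by rewrite (has_length_length Aa) (has_length_length Cc).
Qed.

Lemma length_eq0 X :
  finite_length V -> length (V := V) X = 0%N <-> is_zero (C := V) X.
Proof.
move=> fl; split=> [|/has_length0 /has_length_length //].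
have [n Xn] := fl X; rewrite (has_length_length Xn) => n0.
by apply/has_length0; rewrite -n0.
Qed.

End Length.

(** * Kernels and pullback squares *)

Section PullbackKernel.
Variable V : preadditive.
Implicit Types A B C D : V.

Lemma pullback_kernel A B C D K (f : phom A B) (g : phom C D) (e : phom A C)
    (e' : phom B D) (k : phom K A) :
  is_pullback (C := V) e' g f e -> mono (C := V) f ->
  is_kernel e k -> is_kernel e' (pcomp f k).
Proof.
move=> [/= fe pbP] fm ke; apply: is_kernelI => [||X x e'x].
- exact: mono_comp fm (kernel_mono ke).
- by rewrite pcompA fe -pcompA (proj1 ke) pcompm0.
(* A map killed by [e'] forms a cone with the zero map to [C], so it factors through [A], and there
   through the kernel of [e]. *)
have [|u [[/= fu eu] _]] := pbP X x 0; first by rewrite /= e'x pcompm0.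
have [w kw] := kernel_lift ke eu.
by exists w; rewrite -pcompA kw.
Qed.

(** A cone over [phi] and a map out of a zero object is just a map killed by [phi]. *)
Lemma pullback_zero_kernel Z B D F (phi : phom B D) (z : phom Z D)
    (p : phom F B) (q : phom F Z) :
  is_zero (C := V) Z -> is_pullback (C := V) phi z p q -> is_kernel phi p.
Proof.
move=> Z0 [/= pq pbP]; split=> [|X a phia].
  by rewrite pq (to_zero_eq0 q Z0) pcompm0.
have [|u [[/= pu qu] uU]] := pbP X a 0; first by rewrite /= phia pcompm0.
exists u; split=> // v pv; apply: uU; split=> //=.
exact: to_zero_eq0.
Qed.

End PullbackKernel.

(** * The rank axioms from additivity of length *)

Theorem proposition6 (D : abelianCategory) (hD : finite_length D) :
  let r : abelian_regular D -> int := fun X => Posz (@length D X) in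
  [/\ rank_function r, strict r, zero_based r & fiberwise r].
Proof.
move=> r.
have lmono A B (f : hom (c := D) A B) : mono (C := D) f ->
    exists (Q : D) (q : phom B Q), short_exact f q.
  move=> fm; have [Q [q fq]] := abelian_cokernel (abelian_ax D) f.
  by exists Q, q; apply: short_exact_cokernel.
have lepi A B (e : hom (c := D) A B) : regular_epi (C := D) e ->
    exists (K : D) (k : phom K A), short_exact k e.
  move=> /regular_epi_epi ee.
  have [K [k ke]] := abelian_kernel (abelian_ax D) e.
  by exists K, k; apply: short_exact_kernel.
have rE A B C (i : phom A B) (p : phom B C) :
    short_exact (V := D) i p -> r B = r A + r C.
  by move=> ip; rewrite /r (length_short_exact hD ip) PoszD.
split.
- split.
  + by exists 0 => A.
  + by move=> A B f /lmono [Q [q /rE ->]]; rewrite lerDl.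
  + by move=> B C e /lepi [K [k /rE ->]]; rewrite lerDr.
  + move=> A B C E f g e e' fm gm re re' pb.
    have [K [k ke]] := lepi _ _ _ re; have [_ _ kk] := ke.
    (* [e] and [e'] share the kernel [K], so [r A - r C] and [r B - r E] both equal [r K]. *)
    have fke' := short_exact_kernel (regular_epi_epi re')
      (pullback_kernel (V := D) pb fm kk).
    by rewrite (rE _ _ _ _ _ ke) (rE _ _ _ _ _ fke') opprD addrACA subrr add0r.
- split.
  + move=> A B f fm fi; have [Q [q fq]] := lmono _ _ _ fm.
    (* The gap is the length of the cokernel; if it were 0, the cokernel would be zero and [f]
       invertible. *)
    rewrite (rE _ _ _ _ _ fq) ltrDl /r ltz_nat lt0n; apply/eqP.
    by move=> /(length_eq0 _ hD) /(short_exact_zero_r fq).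
  + move=> B C e re ei; have [K [k ke]] := lepi _ _ _ re.
    rewrite (rE _ _ _ _ _ ke) ltrDr /r ltz_nat lt0n; apply/eqP.
    by move=> /(length_eq0 _ hD) /(short_exact_zero_l ke).
- have [Z Z0] := abelian_zero (abelian_ax D); exists Z; split; first by case: Z0.
  by congr Posz; apply/length_eq0.
- move=> pt B E phi F p q ptT re pb.
  have pt0 : is_zero (C := D) pt.
    apply/is_zeroP; have [f [_ fU]] := ptT pt.
    by rewrite -(fU (pidm _) I) -(fU (0 : phom _ _) I).
  have rpt : r pt = 0 by congr Posz; apply/length_eq0.
  (* The terminal object is zero, so [0] is its only map to [E]; the sum has one term, the length of
     the fiber over [0], which is the kernel of [phi]. *)
  have hom1 : [set: {classic hom pt E}] = [set (0 : phom (p := D) pt E)].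
    by apply/seteqP; split=> // i _; apply: (from_zero_eq0 (V := D)).
  split.
    apply: sub_finite_set (finite_set1 (0 : phom (p := D) pt E)).
    by rewrite -hom1.
  rewrite hom1 fsbig_set1 rpt subr0.
  have kF := pullback_zero_kernel (V := D) pt0 (pb (0 : phom (p := D) pt E)).
  by rewrite (rE _ _ _ _ _ (short_exact_kernel (regular_epi_epi re) kF)) addrK.
Qed.
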